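(* Let $w$ be a submultiplicative weight on $\mathbb{R}^{2d}$ and let $\theta\in\mathcal{M}_w$ be continuous and radial in each time-frequency coordinate. For $\alpha\in\mathbb{N}_0^d$ and $s\in\mathbb{R}$ put $$\tau_{\alpha,s}(\theta)=\int_{\mathbb{R}^{2d}}\theta(z)^s\,\frac{\pi^{|\alpha|}}{\alpha!}\,|z^\alpha|^2e^{-\pi|z|^2}\,dz.$$ Then for every $s,t\in\mathbb{R}$ there exists a constant $C=C(s,t)>0$ such that $$C^{-1}\le\tau_{\alpha,s}(\theta)\,\tau_{\alpha,t}(\theta)\,\tau_{\alpha,-s-t}(\theta)\le C\qquad\text{for all multi-indices }\alpha\in\mathbb{N}_0^d.$$
   Context: $\mathbb{R}^{2d}$ is identified with $\mathbb{C}^d$ via $(x,\xi)\simeq z=x+i\xi$; $z^\alpha=z_1^{\alpha_1}\cdots z_d^{\alpha_d}$, $|\alpha|=\alpha_1+\dots+\alpha_d$, $\alpha!=\alpha_1!\cdots\alpha_d!$. A submultiplicative weight is a locally bounded, even function $w:\mathbb{R}^{2d}\to(0,\infty)$ with $w(z_1+z_2)\le w(z_1)w(z_2)$. $\mathcal{M}_w$ is the set of all $m\in L^\infty_{loc}(\mathbb{R}^{2d})$ with $0<m(z_1+z_2)\le w(z_1)m(z_2)$ for all $z_1,z_2\in\mathbb{R}^{2d}$. Radial in each time-frequency coordinate: $\theta(z)=\theta_0(|z_1|,\dots,|z_d|)$ for some function $\theta_0$ on $[0,\infty)^d$. *)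

(* Defs.v *)
From HB Require Import structures.
From mathcomp Require Import all_boot all_order all_algebra complex.
From mathcomp Require Import all_classical all_reals all_analysis.

Set Implicit Arguments.
Unset Strict Implicit.
Unset Printing Implicit Defensive.
Import Order.TTheory GRing.Theory Num.Theory.
Import numFieldNormedType.Exports.

Local Open Scope classical_set_scope.
Local Open Scope ring_scope.

(* The Borel sigma-algebra of R^n, given as the product sigma-algebra of the
   Borel sigma-algebra that carries [lebesgue_measure], following the library's
   construction for tuples. *)
Definition measure_rV_display : measure_display.
Proof. exact: default_measure_display. Qed.

Section measurable_rV.
Context {R : realType}.
Variable n : nat.

Let coors : 'I_n -> 'rV[R]_n -> measurableTypeR R := fun i v => v ord0 i.

Let rV_set0 : g_sigma_preimage coors set0.
Proof. exact: sigma_algebra0. Qed.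

Let rV_setC A : g_sigma_preimage coors A -> g_sigma_preimage coors (~` A).
Proof. exact: sigma_algebraC. Qed.

Let rV_bigcup (F : (set 'rV[R]_n)^nat) :
  (forall i, g_sigma_preimage coors (F i)) ->
  g_sigma_preimage coors (\bigcup_i (F i)).
Proof. exact: sigma_algebra_bigcup. Qed.

HB.instance Definition _ :=
  @isMeasurable.Build measure_rV_display 'rV[R]_n (g_sigma_preimage coors)
    rV_set0 rV_setC rV_bigcup.

Lemma measurable_rV_coord (i : 'I_n) :
  measurable_fun [set: 'rV[R]_n] (fun v => v ord0 i : measurableTypeR R).
Proof.
move=> _ Y mY; rewrite setTI; apply: sub_sigma_algebra => /=.
rewrite -bigcup_seq/=; exists i => /=; first by rewrite mem_index_enum.
by exists Y => //; rewrite setTI.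
Qed.

Lemma measurable_fun_rVP d (U : measurableType d) (f : U -> 'rV[R]_n) :
  (forall i, measurable_fun setT (fun u => f u ord0 i : measurableTypeR R)) ->
  measurable_fun setT f.
Proof.
move=> mf; pose S : set (set 'rV[R]_n) := [set A | measurable (f @^-1` A)].
have : g_sigma_preimage coors `<=` S.
  apply: smallest_sub.
    split=> /=.
    - by rewrite /S/= preimage_set0.
    - by move=> A; rewrite /S/= setTD preimage_setC => mA; exact: measurableC.
    - move=> F; rewrite /S/= => mF; rewrite preimage_bigcup.
      exact: bigcupT_measurable.
  move=> A; rewrite -bigcup_seq => -[i _] [B mB <-]; rewrite /S/= setTI.
  by rewrite -[X in measurable X]setTI; exact: mf.
by move=> h _ Y mY; rewrite setTI; exact: h.
Qed.

End measurable_rV.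

Definition rV_cons (T : Type) n (p : T * 'rV[T]_n) : 'rV[T]_n.+1 :=
  row_mx (const_mx p.1 : 'rV_1) p.2.

Lemma rV_cons0 (T : Type) n (p : T * 'rV[T]_n) : rV_cons p ord0 ord0 = p.1.
Proof.
have -> : ord0 = lshift n (ord0 : 'I_1) by exact: val_inj.
by apply: etrans (row_mxEl _ _ _ _) _; rewrite mxE.
Qed.

Lemma rV_consS (T : Type) n (p : T * 'rV[T]_n) (j : 'I_n) :
  rV_cons p ord0 (lift ord0 j) = p.2 ord0 j.
Proof.
have -> : lift ord0 j = rshift 1 j by exact: val_inj.
exact: row_mxEr.
Qed.

Section measurable_rV_cons.
Context {R : realType} {n : nat}.

Lemma measurable_rV_cons :
  measurable_fun [set: measurableTypeR R * 'rV[R]_n] (@rV_cons R n).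
Proof.
apply: measurable_fun_rVP => i; have [j ->|->] := unliftP ord0 i.
  under eq_fun do rewrite rV_consS.
  exact: (measurableT_comp (measurable_rV_coord _) measurable_snd).
by under eq_fun do rewrite rV_cons0; exact: measurable_fst.
Qed.

Lemma measurable_rV_uncons : measurable_fun [set: 'rV[R]_n.+1]
  (fun v => (v ord0 ord0 : measurableTypeR R, rsubmx (v : 'rV_(1 + n)))).
Proof.
apply/measurable_fun_pairP; split; first exact: measurable_rV_coord.
apply: measurable_fun_rVP => i /=; under eq_fun do rewrite mxE.
exact: measurable_rV_coord.
Qed.

End measurable_rV_cons.

(* The image of [lebesgue_measure \x mu] under R * R^n ~ R^(n+1). *)
Section cons_measure.
Local Open Scope ereal_scope.
Context {R : realType} {n : nat}.
Variable mu : {sigma_finite_measure set 'rV[R]_n -> \bar R}.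

Definition cons_measure : set 'rV[R]_n.+1 -> \bar R :=
  pushforward (@lebesgue_measure R \x mu) (@rV_cons R n).

Let cons_measure0 : cons_measure set0 = 0.
Proof. by rewrite /cons_measure /pushforward preimage_set0 measure0. Qed.

Let cons_measure_ge0 A : 0 <= cons_measure A.
Proof. by rewrite /cons_measure /pushforward; exact: measure_ge0. Qed.

Let cons_measure_sigma_additive : semi_sigma_additive cons_measure.
Proof.
move=> F mF tF mUF; rewrite /cons_measure /pushforward preimage_bigcup.
apply: measure_semi_sigma_additive.
- by move=> k; rewrite -[X in measurable X]setTI; exact: measurable_rV_cons.
- apply/trivIsetP => /= i j _ _ ij; rewrite -preimage_setI.
  by move/trivIsetP : tF => /(_ _ _ _ _ ij) ->//; rewrite preimage_set0.
- rewrite -preimage_bigcup -[X in measurable X]setTI.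
  exact: measurable_rV_cons.
Qed.

HB.instance Definition _ := isMeasure.Build _ _ _
  cons_measure cons_measure0 cons_measure_ge0 cons_measure_sigma_additive.

Let cons_measure_sigma_finite : sigma_finite setT cons_measure.
Proof.
have /sigma_finiteP[F [FT ndF Foo]] := sigma_finiteT (@lebesgue_measure R).
have /sigma_finiteP[G [GT ndG Goo]] := sigma_finiteT mu.
pose g (v : 'rV[R]_n.+1) := (v ord0 ord0, rsubmx (v : 'rV_(1 + n))).
have gK : cancel (@rV_cons R n) g.
  by move=> [x v]; rewrite /g rV_cons0/= row_mxKr.
exists (fun k => g @^-1` (F k `*` G k)).
  apply/esym; rewrite -subTset => v _.
  have [k _ Fk] : (\bigcup_i F i) (g v).1 by rewrite -FT.
  have [l _ Gl] : (\bigcup_i G i) (g v).2 by rewrite -GT.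
  exists (maxn k l) => //; split.
    by move: Fk; exact/subsetPset/ndF/leq_maxl.
  by move: Gl; exact/subsetPset/ndG/leq_maxr.
move=> k; have [mF Fk] := Foo k; have [mG Gk] := Goo k; split.
  rewrite -[X in measurable X]setTI; apply: measurable_rV_uncons => //.
  exact: measurableX.
rewrite /cons_measure /pushforward -comp_preimage.
rewrite (_ : g \o _ = id); last exact/funext.
by rewrite preimage_id product_measure1E// lte_mul_pinfty// ge0_fin_numE.
Qed.

HB.instance Definition _ := Measure_isSigmaFinite.Build _ _ _
  cons_measure cons_measure_sigma_finite.

End cons_measure.

Fixpoint lebesgue_rV (R : realType) n :
    {sigma_finite_measure set 'rV[R]_n -> \bar R} :=
  match n with
  | 0 => \d_(0 : 'rV[R]_0)
  | n'.+1 => cons_measure (lebesgue_rV R n')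
  end.

(* Characterizes [lebesgue_rV]: the volume of a box is the product of the
   lengths of its sides. *)
Lemma lebesgue_rV_box (R : realType) n (A : 'I_n -> set R) :
  (forall i, measurable (A i : set (measurableTypeR R))) ->
  lebesgue_rV R n [set v | forall i, A i (v ord0 i)] =
  (\prod_(i < n) lebesgue_measure (A i))%E.
Proof.
elim: n A => [|n IHn] A mA.
  by rewrite big_ord0 /= diracE mem_set// => -[].
rewrite big_ord_recl -IHn//= -product_measure1E//; last first.
  rewrite (_ : (fun v => forall i, _) = \bigcap_(i in [set: 'I_n])
      ((fun v : 'rV[R]_n => v ord0 i) @^-1` A (lift ord0 i))); last first.
    by apply/seteqP; split=> v /= Av i => [_|]; exact: Av.
  apply: fin_bigcap_measurable => // i _.
  by rewrite -[X in measurable X]setTI; exact: measurable_rV_coord.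
rewrite /cons_measure /pushforward; congr (_ _).
apply/seteqP; split=> -[x v] /=.
  move=> Axv; split=> [|i]; first by have := Axv ord0; rewrite rV_cons0.
  by have := Axv (lift ord0 i); rewrite rV_consS.
by move=> [Ax Av] i; have [j ->|->] := unliftP ord0 i;
  rewrite ?rV_consS ?rV_cons0.
Qed.

Section weights.
Context {R : realType} {n : nat}.
Implicit Types w m : 'rV[R]_n -> R.

Definition locally_bounded w : Prop :=
  forall z : 'rV[R]_n, bounded_near w (nbhs z).

Definition submultiplicative_weight w : Prop :=
  [/\ forall z, 0 < w z,
      locally_bounded w,
      forall z, w (- z) = w z &
      forall z1 z2, w (z1 + z2) <= w z1 * w z2].

Definition Linfty_loc m : Prop :=
  measurable_fun [set: 'rV[R]_n] m /\
  forall K : set 'rV[R]_n, compact K ->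
    finite_norm (lebesgue_rV R n) +oo (m \_ K).

Definition moderate w m : Prop :=
  Linfty_loc m /\
  forall z1 z2, 0 < m (z1 + z2) /\ m (z1 + z2) <= w z1 * m z2.

(* The norm [`|z|] of the library on row vectors is the supremum norm. *)
Definition euclidean_norm (z : 'rV[R]_n) : R :=
  Num.sqrt (\sum_(i < n) z ord0 i ^+ 2).

End weights.

Section phase_space.
Context {R : realType} {d : nat}.
Implicit Types (z : 'rV[R]_(d + d)) (alpha : 'I_d -> nat).

(* A vector of R^(2d) is [row_mx x xi]; its time-frequency coordinates are
   z_j = x_j + i xi_j. *)
Definition tf_coord z (j : 'I_d) : R[i] :=
  (lsubmx z ord0 j +i* rsubmx z ord0 j)%C.

Definition tf_monomial z alpha : R[i] := \prod_(j < d) tf_coord z j ^+ alpha j.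

Definition multi_degree alpha : nat := (\sum_(j < d) alpha j)%N.

Definition multi_factorial alpha : nat := (\prod_(j < d) (alpha j)`!)%N.

Definition tf_radial (theta : 'rV[R]_(d + d) -> R) : Prop :=
  exists theta0 : 'rV[R]_d -> R,
    forall z, theta z = theta0 (\row_(j < d) Normc.normc (tf_coord z j)).

Definition tau (alpha : 'I_d -> nat) (s : R) (theta : 'rV[R]_(d + d) -> R)
    : \bar R :=
  (\int[lebesgue_rV R (d + d)]_(z in [set: 'rV[R]_(d + d)])
    (theta z `^ s *
     (pi ^+ multi_degree alpha / (multi_factorial alpha)%:R *
      Normc.normc (tf_monomial z alpha) ^+ 2 *
      expR (- (pi * euclidean_norm z ^+ 2))))%:E)%E.

End phase_space.

(* Main.v *)
(** Under the probability density
    pi^|alpha| / alpha! * |z^alpha|^2 * exp (- pi |z|^2) the variables pi |z_j|^2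
    are independent Gamma(alpha_j + 1) variables, so |z_j| stays within O(1), with
    uniform exponential moments, of p_j = sqrt ((alpha_j + N) / pi).  As w grows
    at most exponentially and theta is radial, theta^u stays within a factor Y of
    q^u, where q is the value of theta at the radii p_j and Y is an exponential in
    the distances ||z_j| - p_j|.  Integrating, tau_{alpha,u} agrees with q^u up to
    a factor independent of alpha, and q^s q^t q^(-s-t) = 1.

    Dominating exp (c ||z_j| - p_j|) by two exponentials in |z_j|^2 leaves only
    integrals of |z|^(2a) exp (- b |z|^2), which expand into one-dimensional even
    Gaussian moments. *)
Require Import Defs.
From HB Require Import structures.
From mathcomp Require Import all_boot all_order all_algebra complex.
From mathcomp Require Import all_classical all_reals all_analysis.
From mathcomp Require Import measurable_realfun.
From mathcomp Require Import ring lra.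

Import Order.TTheory GRing.Theory Num.Theory.
Import numFieldNormedType.Exports.

Local Open Scope classical_set_scope.
Local Open Scope ring_scope.

(** * Integrals of nonnegative functions with a finite value *)

Section nonneg_integral.
Context d {T : measurableType d} {R : realType}.
Variable mu : {measure set T -> \bar R}.

(** Bundles the side conditions of the monotone integral calculus, so that sums, scalings and
    products carry them along. As [I] is real, the integral is finite. *)
Definition has_nnintegral (f : T -> R) (I : R) : Prop :=
  [/\ measurable_fun setT f, forall x, 0 <= f x &
      (\int[mu]_x (f x)%:E)%E = I%:E].

Lemma has_nnintegral_ge0 f I : has_nnintegral f I -> 0 <= I.
Proof.
by case=> _ f0 fI; rewrite -lee_fin -fI; apply: integral_ge0 => x _; rewrite lee_fin.
Qed.

Lemma has_nnintegralZ f I c : 0 <= c -> has_nnintegral f I ->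
  has_nnintegral (fun x => c * f x) (c * I).
Proof.
move=> c0 [mf f0 fI]; split.
- exact: measurable_funM.
- by move=> x; rewrite mulr_ge0.
- under eq_integral do rewrite EFinM.
  rewrite ge0_integralZl_EFin//; first by rewrite fI.
  + by move=> x _; rewrite lee_fin.
  + exact/measurable_EFinP.
Qed.

Lemma has_nnintegral_sum (J : Type) (r : seq J) (f : J -> T -> R) (I : J -> R) :
  (forall j, has_nnintegral (f j) (I j)) ->
  has_nnintegral (fun x => \sum_(j <- r) f j x) (\sum_(j <- r) I j).
Proof.
move=> fI; split.
- by apply: measurable_sum => j; case: (fI j).
- by move=> x; apply: sumr_ge0 => j _; case: (fI j).
- under eq_integral do rewrite -sumEFin.
  rewrite ge0_integral_sum//.
  + by rewrite -sumEFin; apply: eq_bigr => j _; case: (fI j).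
  + by move=> j; apply/measurable_EFinP; case: (fI j).
  + by move=> j x _; rewrite lee_fin; case: (fI j).
Qed.

End nonneg_integral.
Arguments has_nnintegral {d T R} mu f I.
Arguments has_nnintegral_ge0 {d T R mu f I}.
Arguments has_nnintegralZ {d T R mu f I c}.
Arguments has_nnintegral_sum {d T R mu J} r {f I}.

(** * Even Gaussian moments on the half-line: recursion by parts *)

Section gaussian_moments.
Context {R : realType}.
Implicit Types (a : R) (k n : nat).
Notation leb := (@lebesgue_measure R).

Definition gauss_mono a k (x : R) : R := x ^+ k.*2 * expR (- (a * x ^+ 2)).

Lemma gauss_mono_ge0 a k x : 0 <= gauss_mono a k x.
Proof. by rewrite mulr_ge0 ?expR_ge0// -muln2 mulnC exprM exprn_ge0// sqr_ge0. Qed.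

Lemma continuous_gauss a : continuous (fun x : R => expR (- (a * x ^+ 2))).
Proof.
move=> x; apply: continuous_comp; last exact: continuous_expR.
by apply: cvgN; apply: cvgM; [exact: cvg_cst|exact: exprn_continuous].
Qed.

Lemma continuous_gauss_mono a k : continuous (gauss_mono a k).
Proof.
move=> x; apply: cvgM; first exact: exprn_continuous.
exact: continuous_gauss.
Qed.

Lemma is_derive_gauss a (x : R) :
  is_derive x (1 : R) (fun x : R => expR (- (a * x ^+ 2)))
    (- (2 * a * x) * expR (- (a * x ^+ 2))).
Proof.
have h : is_derive x (1 : R) (fun x : R => - (a * x ^+ 2)) (- (2 * a * x)).
  apply: is_derive_eq.
  by rewrite /GRing.scale/=; ring.
by apply: is_derive_eq; rewrite /GRing.scale/=; ring.
Qed.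

Lemma is_derive_oo_LRcontinuous (F f : R -> R) (a b : R) :
  (forall x : R, is_derive x (1 : R) F (f x)) -> derivable_oo_LRcontinuous F a b.
Proof.
move=> dF; have cF : continuous F.
  by move=> x; apply: differentiable_continuous; apply/derivable1_diffP.
split; first by move=> x _.
- by apply: cvg_at_right_filter; exact: cF.
- by apply: cvg_at_left_filter; exact: cF.
Qed.

Lemma integrable_gauss_mono a k (b : R) :
  leb.-integrable `[0%R, b] (EFin \o gauss_mono a k).
Proof.
apply: continuous_compact_integrable; first exact: segment_compact.
by apply: continuous_subspaceT; exact: continuous_gauss_mono.
Qed.

(** Integration by parts with x^(2k+1) as primitive of (2k+1) x^(2k); the boundary term at 0
    vanishes. *)
Lemma gauss_mono_parts a k (b : R) : 0 < b ->
  (\int[leb]_(x in `[0%R, b]) gauss_mono a k x) * (k.*2.+1)%:R =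
  b ^+ k.*2.+1 * expR (- (a * b ^+ 2)) +
  2 * a * \int[leb]_(x in `[0%R, b]) gauss_mono a k.+1 x.
Proof.
move=> b0.
have dX (x : R) : is_derive x (1 : R) (fun x : R => x ^+ k.*2.+1)
    ((k.*2.+1)%:R * x ^+ k.*2).
  apply: DeriveDef; first exact: exprn_derivable.
  by rewrite exp_derive /GRing.scale/= mulr1.
rewrite -!RintegralZr ?integrable_gauss_mono//.
have := @Rintegration_by_parts _ (fun x : R => expR (- (a * x ^+ 2)))
  (fun x => x ^+ k.*2.+1) (fun x => - (2 * a * x) * expR (- (a * x ^+ 2)))
  (fun x => (k.*2.+1)%:R * x ^+ k.*2) 0 b b0.
have -> : \int[leb]_(x in `[0%R, b]) (gauss_mono a k x * (k.*2.+1)%:R) =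
  \int[leb]_(x in `[0%R, b])
    (expR (- (a * x ^+ 2)) * ((k.*2.+1)%:R * x ^+ k.*2)).
  by apply: eq_Rintegral => x _; rewrite /gauss_mono; ring.
move=> ->.
- have -> : \int[leb]_(x in `[0%R, b])
     (- (2 * a * x) * expR (- (a * x ^+ 2)) * x ^+ k.*2.+1) =
    - (2 * a) * \int[leb]_(x in `[0%R, b]) gauss_mono a k.+1 x.
    rewrite -RintegralZl ?integrable_gauss_mono//.
    by apply: eq_Rintegral => x _; rewrite /gauss_mono doubleS [x ^+ k.*2.+2]exprS; ring.
  by rewrite !expr0n/= !mulr0 subr0; ring.
- apply: continuous_subspaceT => x; apply: cvgM; last exact: continuous_gauss.
  by apply: cvgN; apply: cvgM; [exact: cvg_cst|exact: cvg_id].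
- exact: (is_derive_oo_LRcontinuous _ _ _ _ (is_derive_gauss a)).
- by move=> x _; rewrite derive1E; exact: (@derive_val _ _ _ _ _ _ _ (is_derive_gauss a x)).
- apply: continuous_subspaceT => x; apply: cvgM; first exact: cvg_cst.
  exact: exprn_continuous.
- exact: (is_derive_oo_LRcontinuous _ _ _ _ dX).
- by move=> x _; rewrite derive1E; exact: (@derive_val _ _ _ _ _ _ _ (dX x)).
Qed.

(** Only the term y^(k+1) / (k+1)! of the series of exp y is kept, at y = a x^2. The factor 1/x then
    kills the boundary term of [gauss_mono_parts] at infinity. *)
Lemma gauss_mono_bound a k (x : R) : 0 < a -> 0 < x ->
  x ^+ k.*2.+1 * expR (- (a * x ^+ 2)) <= (k.+1)`!%:R / a ^+ k.+1 * x^-1.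
Proof.
move=> a0 x0; rewrite expRN ler_pdivrMr ?expR_gt0//.
have ax0 : 0 <= a * x ^+ 2 by rewrite mulr_ge0 ?sqr_ge0 ?ltW.
have := expR_ge1Dxn k ax0; set e := expR _ => he.
have he' : (a * x ^+ 2) ^+ k.+1 / (k.+1)`!%:R <= e by lra.
have := ler_wpM2l _ he' => /(_ ((k.+1)`!%:R / a ^+ k.+1 * x^-1)) h.
apply: (le_trans _ (h _)); last first.
  by rewrite mulr_ge0 ?invr_ge0 ?divr_ge0// ?exprn_ge0// ltW.
rewrite exprMn -exprM mul2n doubleS [x ^+ k.*2.+2]exprS.
have f0 : (k.+1)`!%:R != 0 :> R by rewrite pnatr_eq0 -lt0n fact_gt0.
have an0 : a ^+ k.+1 != 0 by rewrite expf_neq0// gt_eqF.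
rewrite le_eqVlt; apply/orP; left; apply/eqP.
by field; rewrite f0 an0 gt_eqF.
Qed.

Lemma gauss_mono_tail a k : 0 < a ->
  (n%:R : R) ^+ k.*2.+1 * expR (- (a * n%:R ^+ 2)) @[n --> \oo] --> (0 : R).
Proof.
move=> a0.
apply: (@squeeze_cvgr _ _ _ _ (fun=> 0)
  (fun n : nat => (k.+1)`!%:R / a ^+ k.+1 * (n%:R)^-1)).
- near=> n; apply/andP; split; first by rewrite mulr_ge0 ?expR_ge0 ?exprn_ge0.
  by apply: gauss_mono_bound => //; rewrite ltr0n; near: n; exact: nbhs_infty_gt.
- exact: cvg_cst.
- rewrite -[X in _ --> X](mulr0 ((k.+1)`!%:R / a ^+ k.+1)).
  apply: cvgM; first exact: cvg_cst.
  apply/gtr0_cvgV0; last exact: cvgr_idn.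
  by near=> n; rewrite ltr0n; near: n; exact: nbhs_infty_gt.
Unshelve. all: by end_near. Qed.

(** The limit of [gauss_mono_parts] along b = n. Finiteness of one moment, expressed by the real
    value [m], passes to the next. *)
Lemma gauss_mono_rec a k (m : R) : 0 < a ->
  (\int[leb]_(x in `[0%R, +oo[) (gauss_mono a k x)%:E = m%:E)%E ->
  (\int[leb]_(x in `[0%R, +oo[) (gauss_mono a k.+1 x)%:E =
    ((k.*2.+1)%:R / (2 * a) * m)%:E)%E.
Proof.
move=> a0 km.
have mg j : measurable_fun setT (gauss_mono a j).
  by apply: continuous_measurable_fun; exact: continuous_gauss_mono.
have fg j n : (\int[leb]_(x in `[0%R, n%:R]) (gauss_mono a j x)%:E)%E =
    (\int[leb]_(x in `[0%R, n%:R]) gauss_mono a j x)%:E.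
  by rewrite fineK//; apply: integrable_fin_num => //; exact: integrable_gauss_mono.
have := @ge0_cvgn_integral _ leb _ (gauss_mono_ge0 a k.+1) (mg k.+1).
have := @ge0_cvgn_integral _ leb _ (gauss_mono_ge0 a k) (mg k).
rewrite km; under eq_cvg do rewrite fg; under [X in _ -> X -> _]eq_cvg do rewrite fg.
move=> /fine_cvgP[_ hk] hk1.
apply: (cvg_unique _ hk1) => //.
apply: cvg_EFin; first by apply: nearW.
apply: (@cvg_trans _ ((((k.*2.+1)%:R / (2 * a)) * 
   (\int[leb]_(x in `[0%R, n%:R]) gauss_mono a k x)
   - (2 * a)^-1 * (n%:R ^+ k.*2.+1 * expR (- (a * n%:R ^+ 2)))) @[n --> \oo])).
  (* Integration by parts on [0, n] requires n > 0, hence an equality for large n only. *)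
  apply: near_eq_cvg; near=> n => /=.
  have n0 : 0 < n%:R :> R by rewrite ltr0n; near: n; exact: nbhs_infty_gt.
  have := gauss_mono_parts a k n%:R n0; set u := Rintegral _ _ _; set v := Rintegral _ _ _ => h.
  have -> : (k.*2.+1)%:R / (2 * a) * u = (u * (k.*2.+1)%:R) / (2 * a) by ring.
  by rewrite h; field; rewrite gt_eqF.
have -> : (k.*2.+1)%:R / (2 * a) * m =
    (k.*2.+1)%:R / (2 * a) * m - (2 * a)^-1 * 0 by rewrite mulr0 subr0.
apply: cvgB; first by apply: cvgM; [exact: cvg_cst|exact: hk].
by apply: cvgM; [exact: cvg_cst|exact: gauss_mono_tail].
Unshelve. all: by end_near. Qed.

End gaussian_moments.
Arguments gauss_mono_rec {R a k m}.

(** * Moments on the line in closed form and their binomial convolution *)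

Section gaussian_moments_line.
Context {R : realType}.
Implicit Types (a : R) (k n : nat).
Notation leb := (@lebesgue_measure R).

(* The coefficients of (1 - t)^(-1/2). *)
Definition half_binom k : R := \prod_(i < k) ((i.*2.+1)%:R / (i.+1.*2)%:R).

Lemma half_binomS k :
  (k.+1)%:R * half_binom k.+1 = (k%:R + 2^-1) * half_binom k.
Proof.
rewrite /half_binom big_ord_recr/= -!muln2 !natrM -[(k * 2).+1]addn1 natrD natrM.
have : (k.+1)%:R != 0 :> R by rewrite pnatr_eq0.
by rewrite -addn1 natrD => k1; field.
Qed.

(* With c_n the sum, k <-> n - k gives n c_n = 2 sum_k k h_k h_(n-k), and the
   recurrence for (k + 1) h_(k+1) turns this into (n + 1) c_(n+1) = (n + 1) c_n. *)
Lemma half_binom_conv n : \sum_(k < n.+1) half_binom k * half_binom (n - k) = 1.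
Proof.
elim: n => [|n IHn]; first by rewrite big_ord1 subn0 /half_binom !big_ord0 mulr1.
pose c n : R := \sum_(k < n.+1) half_binom k * half_binom (n - k).
have sym m : m%:R * c m = 2 * \sum_(k < m.+1) k%:R * half_binom k * half_binom (m - k).
  rewrite [2 * _]mulr_natl mulr2n {2}(reindex_inj rev_ord_inj)/= -big_split/= mulr_sumr.
  apply: eq_bigr => k _; have km : (k <= m)%N by rewrite -ltnS.
  by rewrite subSS subKn// natrB//; ring.
suff : (n.+1)%:R * c n.+1 = (n.+1)%:R * c n.
  have n0 : (n.+1)%:R != 0 :> R by rewrite pnatr_eq0.
  by move/(mulfI n0); rewrite -IHn.
rewrite sym big_ord_recl/= !mul0r add0r.
under eq_bigr => k _ do rewrite /bump/= add1n half_binomS subSS mulrDl mulrDl.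
rewrite big_split/= mulrDr -sym.
under [X in _ + 2 * X]eq_bigr => k _ do rewrite -mulrA.
by rewrite -mulr_sumr mulrA divff// mul1r -[(n.+1)%:R]natr1 mulrDl mul1r.
Qed.

(** This is Gamma(k + 1/2) / a^(k + 1/2). With k! factored out, the convolution of two moments
    reduces to [half_binom_conv]. *)
Definition gauss_moment a k : R :=
  Num.sqrt (pi / a) * ((k`!)%:R / a ^+ k * half_binom k).

Lemma gauss_momentS a k : 0 < a ->
  gauss_moment a k.+1 = (k.*2.+1)%:R / (2 * a) * gauss_moment a k.
Proof.
move=> a0; rewrite /gauss_moment factS natrM exprS.
have -> : ((k.+1)%:R * k`!%:R / (a * a ^+ k) * half_binom k.+1) =
  ((k`!)%:R / (a * a ^+ k)) * ((k.+1)%:R * half_binom k.+1) by ring.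
rewrite half_binomS -[(k.*2.+1)%:R]natr1 -muln2 natrM.
by field; rewrite expf_neq0 gt_eqF.
Qed.

Lemma gauss_mono_integral a k : 0 < a ->
  has_nnintegral leb (gauss_mono a k) (gauss_moment a k).
Proof.
move=> a0; split.
- by apply: continuous_measurable_fun; exact: continuous_gauss_mono.
- exact: gauss_mono_ge0.
(* By evenness everything reduces to the half-line, where the recursion holds. *)
have half j : (\int[leb]_x (gauss_mono a j x)%:E)%E =
   (2%:E * \int[leb]_(x in `[0%R, +oo[) (gauss_mono a j x)%:E)%E.
  rewrite ge0_symfun_integralT.
  - by rewrite set_itvcy.
  - exact: gauss_mono_ge0.
  - exact: continuous_gauss_mono.
  - by move=> x; rewrite /gauss_mono/= exprNn sqrrN -signr_odd odd_double mul1r.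
suff {k} hk k : (\int[leb]_(x in `[0%R, +oo[) (gauss_mono a k x)%:E)%E =
    (2^-1 * gauss_moment a k)%:E.
  by rewrite half hk -EFinM mulrA divff// mul1r.
elim: k => [|k IHk]; last first.
  by rewrite (gauss_mono_rec a0 IHk) gauss_momentS//; congr EFin; ring.
(* With variance 1 / (2a) the normal density is proportional to exp (- a x^2), so its total mass 1
   gives the moment of order 0. *)
pose s := Num.sqrt (2 * a)^-1.
have sn0 : s != 0 by rewrite gt_eqF// sqrtr_gt0 invr_gt0 mulr_gt0.
have s2 : s ^+ 2 = (2 * a)^-1 by rewrite sqr_sqrtr// invr_ge0 mulr_ge0// ltW.
have pdf1 : has_nnintegral leb (normal_pdf 0 s) 1.
  split; [exact: measurable_normal_pdf|exact: normal_pdf_ge0|].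
  exact: integral_normal_pdf.
have peak0 := normal_peak_gt0 sn0.
have [|_ _] := has_nnintegralZ (c := (normal_peak s)^-1) _ pdf1.
  by rewrite invr_ge0 ltW.
have -> : (\int[leb]_x ((normal_peak s)^-1 * normal_pdf 0 s x)%:E)%E =
    (\int[leb]_x (gauss_mono a 0 x)%:E)%E.
  apply: eq_integral => x _; rewrite normal_pdfE// mulrA mulVf ?gt_eqF// mul1r.
  rewrite /normal_fun /gauss_mono subr0 expr0 mul1r s2.
  by congr (expR _)%:E; rewrite -mulr_natr; field; rewrite gt_eqF.
rewrite half /normal_peak invrK mulr1 s2.
rewrite /gauss_moment /half_binom big_ord0 expr0 invr1 !mulr1.
have -> : (2 * a)^-1 * pi *+ 2 = pi / a.
  by rewrite -mulr_natr; field; rewrite gt_eqF.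
by move=> h; rewrite EFinM -h muleA -EFinM mulVf// mul1e.
Qed.

(** The binomial coefficient cancels the factorials k! and (n - k)!, leaving [half_binom_conv]. With
    [planar_expansion] this evaluates the integral of |z|^(2n) exp (- a |z|^2) over the plane
    without polar coordinates. *)
Lemma gauss_moment_conv a n : 0 < a ->
  \sum_(k < n.+1) 'C(n, k)%:R * (gauss_moment a (n - k) * gauss_moment a k) =
  pi * n`!%:R / a ^+ n.+1.
Proof.
move=> a0; transitivity ((pi / a * (n`!%:R / a ^+ n)) *
    \sum_(k < n.+1) half_binom k * half_binom (n - k)).
  rewrite mulr_sumr; apply: eq_bigr => k _.
  have kn : (k <= n)%N by rewrite -ltnS.
  rewrite /gauss_moment.
  have f k' : (k'`!)%:R != 0 :> R by rewrite pnatr_eq0 -lt0n fact_gt0.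
  have : Num.sqrt (pi / a) * Num.sqrt (pi / a) = pi / a.
    by rewrite -expr2 sqr_sqrtr// divr_ge0 ?pi_ge0// ltW.
  move: (Num.sqrt _) => q sq.
  have an : a ^+ n = a ^+ k * a ^+ (n - k) by rewrite -exprD subnKC.
  have := bin_fact kn => /(congr1 (fun i => i%:R : R)); rewrite !natrM => <-.
  rewrite an -sq; field.
  by rewrite !expf_neq0 ?gt_eqF.
by rewrite half_binom_conv exprS; field; rewrite expf_neq0 gt_eqF.
Qed.

Lemma planar_expansion a n (x y : R) :
  (x ^+ 2 + y ^+ 2) ^+ n * expR (- (a * (x ^+ 2 + y ^+ 2))) =
  \sum_(k < n.+1) 'C(n, k)%:R * (gauss_mono a (n - k) x * gauss_mono a k y).
Proof.
rewrite exprDn mulr_suml; apply: eq_bigr => k _.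
rewrite mulrDr opprD expRD -!exprM !mul2n /gauss_mono -mulr_natr; ring.
Qed.

End gaussian_moments_line.

(** * Product integrals over R^n and over the d complex coordinates *)

Section product_integrals.
Context {R : realType}.
Notation leb := (@lebesgue_measure R).

(** Tonelli's theorem, splitting off one coordinate at a time. *)
Lemma has_nnintegral_prod_rV n (f : 'I_n -> R -> R) (I : 'I_n -> R) :
  (forall i, has_nnintegral leb (f i) (I i)) ->
  has_nnintegral (lebesgue_rV R n)
    (fun v => \prod_i f i (v ord0 i)) (\prod_i I i).
Proof.
move=> fI; split.
- apply: measurable_prod => i _.
  by apply: measurableT_comp; [case: (fI i)|exact: measurable_rV_coord].
- by move=> v; apply: prodr_ge0 => i _; case: (fI i).
elim: n f I fI => [|n IHn] f I fI.
  rewrite big_ord0 /=; under eq_integral do rewrite big_ord0.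
  by rewrite integral_cst//= diracT mule1.
have mP m (g : 'I_m -> R -> R) (J : 'I_m -> R) :
    (forall i, has_nnintegral leb (g i) (J i)) ->
    measurable_fun setT (fun v : 'rV[R]_m => (\prod_i g i (v ord0 i))%:E).
  move=> gJ; apply/measurable_EFinP; apply: measurable_prod => i _.
  by apply: measurableT_comp; [case: (gJ i)|exact: measurable_rV_coord].
have pos m (g : 'I_m -> R -> R) (J : 'I_m -> R) (v : 'rV[R]_m) :
    (forall i, has_nnintegral leb (g i) (J i)) -> 0 <= \prod_i g i (v ord0 i).
  by move=> gJ; apply: prodr_ge0 => i _; case: (gJ i).
(* The measure on R^(n+1) is by construction the image of a product measure, so the integral pulls
   back to pairs. *)
rewrite ge0_integral_pushforward//=; last 3 first.
- exact: measurable_rV_cons.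
- exact: mP fI.
- by move=> v _; rewrite lee_fin; exact: pos fI.
rewrite preimage_setT fubini_tonelli1; last 2 first.
- by apply: (measurableT_comp (mP _ _ _ fI)); exact: measurable_rV_cons.
- by move=> v; rewrite lee_fin; exact: pos fI.
rewrite /fubini_F/=.
have fI' j : has_nnintegral leb (f (lift ord0 j)) (I (lift ord0 j)) by [].
have inner x : (\int[lebesgue_rV R n]_v
      (\prod_i f i (rV_cons (x, v) ord0 i))%:E)%E =
    (\prod_i I (lift ord0 i) * f ord0 x)%:E.
  transitivity (\int[lebesgue_rV R n]_v
      ((f ord0 x)%:E * (\prod_i f (lift ord0 i) (v ord0 i))%:E))%E.
    apply: eq_integral => v _; rewrite -EFinM big_ord_recl rV_cons0.
    by congr (_ * _)%:E; apply: eq_bigr => i _; rewrite rV_consS.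
  rewrite ge0_integralZl_EFin//; last 3 first.
  - by move=> v _; rewrite lee_fin; exact: pos fI'.
  - exact: mP fI'.
  - by case: (fI ord0).
  by rewrite (IHn _ _ fI') -EFinM mulrC.
under eq_integral do rewrite inner.
have I0 : 0 <= \prod_i I (lift ord0 i).
  by apply: prodr_ge0 => i _; apply: has_nnintegral_ge0 (fI' i).
have [_ _ ->] := has_nnintegralZ I0 (fI ord0).
by rewrite big_ord_recl mulrC.
Qed.

(** Distributivity turns the product of sums into a sum over all choice functions [g]. *)
Lemma has_nnintegral_prod_sum d (T : measurableType d)
    (mu : {measure set T -> \bar R}) (K J : finType)
    (f : K -> J -> T -> R) (I : K -> J -> R) :
  (forall g : {ffun K -> J},
    has_nnintegral mu (fun x => \prod_k f k (g k) x) (\prod_k I k (g k))) ->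
  has_nnintegral mu (fun x => \prod_k \sum_j f k j x) (\prod_k \sum_j I k j).
Proof.
move=> fI; rewrite bigA_distr_bigA; under eq_fun do rewrite bigA_distr_bigA.
exact: has_nnintegral_sum fI.
Qed.

(** This is |z_j|^2, in the real coordinates in which the measure is a product. *)
Definition sqmod {d} (z : 'rV[R]_(d + d)) (j : 'I_d) : R :=
  z ord0 (lshift d j) ^+ 2 + z ord0 (rshift d j) ^+ 2.

Lemma has_nnintegral_planar d (n : 'I_d -> nat) (a : 'I_d -> R) :
  (forall j, 0 < a j) ->
  has_nnintegral (lebesgue_rV R (d + d))
    (fun z => \prod_(j < d) (sqmod z j ^+ n j * expR (- (a j * sqmod z j))))
    (\prod_(j < d) (pi * (n j)`!%:R / a j ^+ (n j).+1)).
Proof.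
(* [has_nnintegral_prod_sum] needs one index type for all j. The sums are extended to the common
   length N + 1; the added binomial coefficients vanish. *)
move=> a0; pose N := \max_j n j.
have widen (F : nat -> R) j :
    \sum_(k < (n j).+1) 'C(n j, k)%:R * F k = \sum_(k < N.+1) 'C(n j, k)%:R * F k.
  have nN : (n j <= N)%N by exact: leq_bigmax.
  rewrite (big_ord_widen_cond N.+1 xpredT (fun k => 'C(n j, k)%:R * F k))//.
  rewrite big_mkcond/=; apply: eq_bigr => k _; case: ifPn => //.
  by rewrite -leqNgt => nk; rewrite bin_small ?mul0r.
have fE z j : sqmod z j ^+ n j * expR (- (a j * sqmod z j)) =
    \sum_(k < N.+1) 'C(n j, k)%:R * (gauss_mono (a j) (n j - k) (z ord0 (lshift d j))
      * gauss_mono (a j) k (z ord0 (rshift d j))).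
  rewrite planar_expansion; exact: (widen (fun k => gauss_mono _ (n j - k) _ *
    gauss_mono _ k _)).
have IE j : pi * (n j)`!%:R / a j ^+ (n j).+1 =
    \sum_(k < N.+1) 'C(n j, k)%:R *
      (gauss_moment (a j) (n j - k) * gauss_moment (a j) k).
  rewrite -gauss_moment_conv//; exact: (widen (fun k => gauss_moment _ (n j - k) *
    gauss_moment _ k)).
under eq_fun => z do under eq_bigr => j _ do rewrite fE.
under eq_bigr => j _ do rewrite IE.
apply: has_nnintegral_prod_sum => g.
rewrite big_split/=; under eq_fun do rewrite big_split/=.
apply: has_nnintegralZ; first by apply: prodr_ge0 => j _.
(* For a fixed choice [g] the integrand is a product over the 2d real coordinates: the left half
   consists of the x_j, the right half of the xi_j. *)
pose f (i : 'I_(d + d)) : R -> R := match fintype.split i with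
  | inl j => gauss_mono (a j) (n j - g j) | inr j => gauss_mono (a j) (g j) end.
pose I (i : 'I_(d + d)) : R := match fintype.split i with
  | inl j => gauss_moment (a j) (n j - g j) | inr j => gauss_moment (a j) (g j) end.
have fI i : has_nnintegral leb (f i) (I i).
  by rewrite /f /I; case: (fintype.split i) => j; exact: gauss_mono_integral.
have := has_nnintegral_prod_rV _ _ _ fI.
congr has_nnintegral.
  apply/funext => z; rewrite big_split_ord/= big_split/=; congr (_ * _).
    by apply: eq_bigr => j _; rewrite /f (unsplitK (inl j)).
  by apply: eq_bigr => j _; rewrite /f (unsplitK (inr j)).
rewrite big_split_ord/= big_split/=; congr (_ * _).
  by apply: eq_bigr => j _; rewrite /I (unsplitK (inl j)).
by apply: eq_bigr => j _; rewrite /I (unsplitK (inr j)).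
Qed.

End product_integrals.

(** * Exponential growth of submultiplicative weights *)

Section weights.
Context {R : realType}.

Lemma mx_norm_le_sum n (v : 'rV[R]_n) : `|v| <= \sum_i `|v ord0 i|.
Proof.
have -> : `|v| = mx_norm v by [].
have [->|/mx_norm_neq0[[i j] ->]] := eqVneq (mx_norm v) 0.
  by apply: sumr_ge0.
by rewrite /= (ord1 i) (bigD1 j)//= lerDl; apply: sumr_ge0.
Qed.

(** From w(0) <= w(0)^2 follows w(0) >= 1, and evenness gives w(0) <= w(v) w(-v) = w(v)^2. *)
Lemma submultiplicative_weight_ge1 n (w : 'rV[R]_n -> R) v :
  submultiplicative_weight w -> 1 <= w v.
Proof.
move=> [w0 _ wN wD].
have w01 : 1 <= w 0 by have := wD 0 0; rewrite addr0 -{1}[w 0]mulr1 ler_pM2l.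
have := wD v (- v); rewrite subrr wN -expr2 => /(le_trans w01).
by rewrite expr_ge1// ltW.
Qed.

(** A vector is a sum of short equal pieces on which w is bounded, and their number grows linearly
    with the norm. The l^1 norm is used because its exponential factors over coordinates. *)
Lemma submultiplicative_weight_exp n (w : 'rV[R]_n -> R) :
  submultiplicative_weight w ->
  exists K c : R, [/\ 1 <= K, 0 <= c &
    forall v, w v <= K * expR (c * \sum_i `|v ord0 i|)].
Proof.
move=> ww; have w1 := fun v => submultiplicative_weight_ge1 n w v ww.
case: (ww) => w0 wb _ wD.
have [B [B1 [e [e0 wB]]]] : exists B, 1 <= B /\ exists e, 0 < e /\
    forall v, `|v| < e -> w v <= B.
  have /pinfty_ex_gt0[B B0 /nbhs_norm0P[e /= e0 he]] := wb 0.
  (* The maximum with 1 makes ln B nonnegative. *)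
  exists (Num.max 1 B); split; first by rewrite le_max lexx.
  exists e; split => // v ve; rewrite le_max; apply/orP; right.
  by rewrite (le_trans (ler_norm _))//; apply: he.
have wMn v m : w (v *+ m.+1) <= w v ^+ m.+1.
  elim: m => [|m IHm]; first by rewrite mulr1n expr1.
  by rewrite mulrS exprS (le_trans (wD _ _))// ler_pM2l.
have lnB : 0 <= ln B by exact: ln_ge0.
have Bpos : 0 < B by exact: lt_le_trans B1.
exists B, (e^-1 * ln B); split => //; first by rewrite mulr_ge0 ?invr_ge0// ltW.
(* Cutting v into m + 1 equal pieces makes each of norm less than e. *)
move=> v; pose m := Num.truncn (`|v| / e).
have /andP[m1 m2] : m%:R <= `|v| / e < m.+1%:R.
  by apply: truncn_itv; rewrite divr_ge0// ltW.
have wu : w ((m.+1%:R)^-1 *: v) <= B.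
  by apply: wB; rewrite normrZ ger0_norm ?invr_ge0// mulrC ltr_pdivrMr// mulrC
    -ltr_pdivrMr.
have -> : v = ((m.+1%:R)^-1 *: v) *+ m.+1.
  by rewrite -scaler_nat scalerA divff ?scale1r ?pnatr_eq0.
apply: (le_trans (wMn _ _)).
rewrite -scaler_nat scalerA divff ?scale1r ?pnatr_eq0//.
apply: (@le_trans _ _ (B ^+ m.+1)).
  by apply: lerXn2r; rewrite ?nnegrE// ltW.
rewrite exprS ler_pM2l// -{1}(lnK (x := B))// -expRM_natl ler_expR.
rewrite mulrAC ler_wpM2r//; apply: (le_trans m1).
by rewrite mulrC ler_pM2l ?invr_gt0// mx_norm_le_sum.
Qed.

(** In logarithms: |ln x| <= ln W gives |s ln x| <= S ln W, for either sign of s. *)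
Lemma powR_le_weight (x W s S : R) : 1 <= W -> W^-1 <= x -> x <= W ->
  `|s| <= S -> (W `^ S)^-1 <= x `^ s /\ x `^ s <= W `^ S.
Proof.
move=> W1 Wx xW sS.
have W0 : 0 < W by exact: lt_le_trans W1.
have x0 : 0 < x by rewrite (lt_le_trans _ Wx)// invr_gt0.
have lW : 0 <= ln W by exact: ln_ge0.
have : `|s * ln x| <= S * ln W.
  rewrite normrM ler_pM// ler_norml -lnV// !ler_ln ?posrE ?invr_gt0//.
  by rewrite Wx xW.
rewrite ler_norml => /andP[l u].
by rewrite /powR !gt_eqF// -expRN !ler_expR l u.
Qed.

End weights.

(** * Exponentials of radii and Laplace transforms of Gamma laws *)

Section radial_estimates.
Context {R : realType}.

(* [|r - p| <= |r^2 - p^2| / p] turns an exponential in the radius into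
   exponentials in the squared radius, whose Gaussian moments are explicit. *)
Lemma expR_dist_le (c r p : R) : 0 <= c -> 0 <= r -> 0 < p ->
  expR (c * `|r - p|) <=
  expR (c / p * (r ^+ 2 - p ^+ 2)) + expR (- (c / p * (r ^+ 2 - p ^+ 2))).
Proof.
move=> c0 r0 p0; set x := c / p * _.
have cx : c * `|r - p| <= `|x|.
  rewrite /x normrM (ger0_norm (divr_ge0 c0 (ltW p0))) -mulrA ler_wpM2l//.
  rewrite subr_sqr normrM [_ * `|r + p|]mulrC mulrA ler_peMl//.
  rewrite (ger0_norm (addr_ge0 r0 (ltW p0))).
  by rewrite mulrC ler_pdivlMr// mul1r lerDr.
apply: (@le_trans _ _ (expR `|x|)); first by rewrite ler_expR.
by case: ger0P => _; rewrite ?lerDl ?lerDr expR_ge0.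
Qed.

(** After clearing the denominator, the slack in 1 / (1 - l) <= 1 + l + 2 l^2 is l^2 (1 - 2 l),
    hence the range l <= 1/2. *)
Lemma inv1B_le_expR (l : R) : 0 <= l <= 2^-1 -> (1 - l)^-1 <= expR (l + 2 * l ^+ 2).
Proof.
move=> /andP[l0 l1]; apply: le_trans (expR_ge1Dx _).
by rewrite -div1r ler_pdivrMr; nra.
Qed.

Lemma inv1D_le_expR (l : R) : 0 <= l -> (1 + l)^-1 <= expR (- l + l ^+ 2).
Proof.
move=> l0; apply: le_trans (expR_ge1Dx _).
by rewrite -div1r ler_pdivrMr; nra.
Qed.

(* Bounds for the Laplace transform of the Gamma(a + 1) law, centred at a + N,
   at the frequencies of order (a + N)^(-1/2). *)
Lemma gamma_laplace_le (a N : nat) (l b : R) : (0 < N)%N -> 0 <= l <= 2^-1 ->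
  l ^+ 2 * (a + N)%:R = b ->
  expR (- (l * (a + N)%:R)) * (1 - l)^-1 ^+ a.+1 <= expR (2 * b).
Proof.
move=> N0 l01 <-; case/andP: (l01) => l0 l1.
apply: (@le_trans _ _ (expR (- (l * (a + N)%:R)) * expR (l + 2 * l ^+ 2) ^+ a.+1)).
  rewrite ler_pM2l ?expR_gt0//; apply: lerXn2r; rewrite ?nnegrE ?expR_ge0//.
    by rewrite invr_ge0; lra.
  exact: inv1B_le_expR.
rewrite -expRM_natl -expRD ler_expR natrD -[a.+1]addn1 natrD.
have : 1 <= N%:R :> R by rewrite ler1n.
have : 0 <= a%:R :> R by [].
by move: (a%:R) (N%:R) => A M; nra.
Qed.

(** The linear terms leave l (N - 1) <= N, the price of centring at a + N; the quadratic term l^2 (a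
    + 1) is at most b because N >= 1. *)
Lemma gamma_laplaceN_le (a N : nat) (l b : R) : (0 < N)%N -> 0 <= l <= 2^-1 ->
  l ^+ 2 * (a + N)%:R = b ->
  expR (l * (a + N)%:R) * (1 + l)^-1 ^+ a.+1 <= expR (N%:R + b).
Proof.
move=> N0 l01 <-; case/andP: (l01) => l0 l1.
apply: (@le_trans _ _ (expR (l * (a + N)%:R) * expR (- l + l ^+ 2) ^+ a.+1)).
  rewrite ler_pM2l ?expR_gt0//; apply: lerXn2r; rewrite ?nnegrE ?expR_ge0//.
    by rewrite invr_ge0; lra.
  exact: inv1D_le_expR.
rewrite -expRM_natl -expRD ler_expR natrD -[a.+1]addn1 natrD.
have : 1 <= N%:R :> R by rewrite ler1n.
have : 0 <= a%:R :> R by [].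
by move: (a%:R) (N%:R) => A M; nra.
Qed.

End radial_estimates.

(** * Two-sided bounds for an integral against a probability density *)

Section sandwich.
Context d {T : measurableType d} {R : realType}.
Variable mu : {measure set T -> \bar R}.

(* The lower bound uses [1 / y >= 2 / M - y / M ^+ 2], a weak form of Jensen's
   inequality. *)
Lemma integral_sandwich (D Y F : T -> R) (I M q : R) :
  has_nnintegral mu D 1 -> has_nnintegral mu (fun z => Y z * D z) I ->
  I <= M -> 0 < M -> 0 < q -> measurable_fun setT F ->
  (forall z, [/\ 0 < Y z, q / Y z <= F z & F z <= q * Y z]) ->
  ((q / M)%:E <= \int[mu]_z (F z * D z)%:E <= (q * M)%:E)%E.
Proof.
move=> hD hYD IM M0 q0 mF FY.
case: (hD) => mD D0 ID; case: (hYD) => mYD YD0 IYD.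
have q0' := ltW q0.
have mFD : measurable_fun setT (fun z => F z * D z) by exact: measurable_funM.
have FD0 z : 0 <= F z * D z.
  have [Y0 qF _] := FY z.
  by rewrite mulr_ge0// (le_trans _ qF)// divr_ge0// ltW.
apply/andP; split; last first.
  have [mqYD qYD0 IqYD] := has_nnintegralZ q0' hYD.
  apply: (@le_trans _ _ (q * I)%:E); last by rewrite lee_fin ler_pM2l.
  rewrite -IqYD; apply: ge0_le_integral => //.
  - by move=> z _; rewrite lee_fin.
  - exact/measurable_EFinP.
  - exact/measurable_EFinP.
  - move=> z _; rewrite lee_fin mulrA ler_wpM2r//.
    by have [] := FY z.
have qM0 : 0 <= q / M ^+ 2 by rewrite divr_ge0// exprn_ge0// ltW.
have [mqYD qYD0 IqYD] := has_nnintegralZ qM0 hYD.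
have qM1 : 0 <= 2 * q / M by rewrite divr_ge0 ?mulr_ge0// ltW.
have [mqD qD0 IqD] := has_nnintegralZ qM1 hD.
(* The negative term of the minorant is moved to the right-hand side, so that all integrands stay
   nonnegative. *)
have : ((2 * q / M * 1)%:E <=
    \int[mu]_z (F z * D z)%:E + (q / M ^+ 2 * I)%:E)%E.
  rewrite -IqD -IqYD -ge0_integralD//; last 4 first.
  - by move=> z _; rewrite lee_fin.
  - exact/measurable_EFinP.
  - by move=> z _; rewrite lee_fin.
  - exact/measurable_EFinP.
  apply: ge0_le_integral => //.
  - by move=> z _; rewrite lee_fin.
  - exact/measurable_EFinP.
  - by apply/measurable_EFinP; exact: measurable_funD.
  - move=> z _; rewrite -EFinD lee_fin mulrA -mulrDl ler_wpM2r//.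
    have [Y0 qF _] := FY z; rewrite -lerBlDr (le_trans _ qF)//.
    rewrite -subr_ge0.
    have -> : q / Y z - (2 * q / M - q / M ^+ 2 * Y z) =
        q / (Y z) * ((M - Y z) / M) ^+ 2 by field; rewrite !gt_eqF.
    exact: mulr_ge0 (divr_ge0 q0' (ltW Y0)) (sqr_ge0 _).
(* The value +oo satisfies the lower bound trivially; -oo contradicts the inequality just
   obtained. *)
rewrite mulr1; case: (\int[mu]_z _)%E => [x| |]/=; [|by move=> _; rewrite leey|by rewrite leeNy_eq].
rewrite -EFinD !lee_fin => h.
have : q / M ^+ 2 * I <= q / M.
  rewrite (le_trans (ler_wpM2l qM0 IM))// le_eqVlt; apply/orP; left.
  by apply/eqP; field; rewrite gt_eqF.
by move: h; rewrite -mulrA; lra.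
Qed.

End sandwich.
Arguments integral_sandwich {d T R mu D Y F I M q}.

(** * The density of the monomials and its exponential tilts *)

Section phase_space_density.
Context {R : realType} {d : nat}.
Implicit Types (z : 'rV[R]_(d + d)) (alpha : 'I_d -> nat).

Definition density alpha z : R := \prod_(j < d)
  (pi ^+ alpha j / (alpha j)`!%:R *
    (sqmod z j ^+ alpha j * expR (- (pi * sqmod z j)))).

Lemma sqmod_ge0 z j : 0 <= sqmod z j.
Proof. by rewrite addr_ge0 ?sqr_ge0. Qed.

Lemma normc_tf_coord z j : Normc.normc (tf_coord z j) = Num.sqrt (sqmod z j).
Proof. by rewrite /tf_coord /= !mxE. Qed.

Lemma tau_densityE alpha (s : R) (theta : 'rV[R]_(d + d) -> R) :
  tau alpha s theta =
  (\int[lebesgue_rV R (d + d)]_z (theta z `^ s * density alpha z)%:E)%E.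
Proof.
apply: eq_integral => z _; congr (_ * _)%:E.
have normcX (x : R[i]) n : Normc.normc (x ^+ n) = Normc.normc x ^+ n.
  by elim: n => [|n IHn]; rewrite ?Normc.normc1// !exprS Normc.normcM IHn.
have -> : Normc.normc (tf_monomial z alpha) ^+ 2 =
    \prod_(j < d) sqmod z j ^+ alpha j.
  have -> : Normc.normc (tf_monomial z alpha) =
      \prod_(j < d) Num.sqrt (sqmod z j) ^+ alpha j.
    rewrite /tf_monomial (big_morph _ (@Normc.normcM R) (@Normc.normc1 R)).
    by apply: eq_bigr => j _; rewrite normcX normc_tf_coord.
  rewrite -prodrXl; apply: eq_bigr => j _.
  by rewrite exprAC sqr_sqrtr// sqmod_ge0.
have -> : euclidean_norm z ^+ 2 = \sum_(j < d) sqmod z j.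
  rewrite /euclidean_norm sqr_sqrtr; last by apply: sumr_ge0 => j _; exact: sqr_ge0.
  by rewrite big_split_ord/= -big_split.
rewrite mulr_sumr -sumrN expR_sum /multi_degree /multi_factorial.
rewrite -prodrXr natr_prod -prodf_div -!big_split/=.
by apply: eq_bigr => j _; rewrite mulrA.
Qed.

Lemma density_integral alpha :
  has_nnintegral (lebesgue_rV R (d + d)) (density alpha) 1.
Proof.
have pi0 : 0 < pi :> R by exact: pi_gt0.
have c0 : 0 <= \prod_(j < d) (pi ^+ alpha j / (alpha j)`!%:R) :> R.
  by apply: prodr_ge0 => j _; rewrite divr_ge0 ?exprn_ge0// ltW.
have := has_nnintegralZ c0 (has_nnintegral_planar _ alpha _ (fun=> pi0)).
congr has_nnintegral; first by apply/funext => z /=; rewrite -big_split.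
rewrite -big_split/= big1// => j _.
have f0 : (alpha j)`!%:R != 0 :> R by rewrite pnatr_eq0 -lt0n fact_gt0.
have p0 : pi != 0 :> R by rewrite gt_eqF.
by rewrite exprS; move: pi p0 => p p0; field; rewrite f0 p0 expf_neq0.
Qed.

(** A tilt by exp (+- l_j pi |z_j|^2) only changes the Gaussian rate pi into pi (1 -+ l_j), which
    stays positive for |l_j| < 1, so [has_nnintegral_planar] applies. *)
Lemma density_tilted alpha (l m : 'I_d -> R) :
  (forall j, `|l j| < 1) ->
  has_nnintegral (lebesgue_rV R (d + d))
    (fun z => \prod_(j < d) (expR (l j * (pi * sqmod z j - m j)) +
                             expR (- (l j * (pi * sqmod z j - m j)))) *
              density alpha z)
    (\prod_(j < d) (expR (- (l j * m j)) * (1 - l j)^-1 ^+ (alpha j).+1 +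
                    expR (l j * m j) * (1 + l j)^-1 ^+ (alpha j).+1)).
Proof.
move=> l1; have pi0 : 0 < pi :> R by exact: pi_gt0.
(* The boolean records the sign of the tilt, so that the product of two-term sums expands over sign
   vectors. *)
pose sl j (b : bool) : R := if b then l j else - l j.
have sl1 j b : 0 < 1 - sl j b.
  by have := l1 j; rewrite ltr_norml => /andP[] ? ?; rewrite /sl; case: b; lra.
pose f j b z := pi ^+ alpha j / (alpha j)`!%:R * expR (- (sl j b * m j)) *
  (sqmod z j ^+ alpha j * expR (- (pi * (1 - sl j b) * sqmod z j))).
pose I j b := expR (- (sl j b * m j)) * (1 - sl j b)^-1 ^+ (alpha j).+1.
have fI (g : {ffun 'I_d -> bool}) : has_nnintegral (lebesgue_rV R (d + d))
    (fun z => \prod_(j < d) f j (g j) z) (\prod_(j < d) I j (g j)).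
  pose c := \prod_(j < d)
    (pi ^+ alpha j / (alpha j)`!%:R * expR (- (sl j (g j) * m j))).
  have c0 : 0 <= c.
    by apply: prodr_ge0 => j _;
      rewrite mulr_ge0 ?expR_ge0// divr_ge0 ?exprn_ge0// ltW.
  have a0 j : 0 < pi * (1 - sl j (g j)) by rewrite mulr_gt0.
  have := has_nnintegralZ c0 (has_nnintegral_planar _ alpha _ a0).
  congr has_nnintegral; first by apply/funext => z /=; rewrite -big_split.
  rewrite -big_split/=; apply: eq_bigr => j _.
  have f0 : (alpha j)`!%:R != 0 :> R by rewrite pnatr_eq0 -lt0n fact_gt0.
  have := sl1 j (g j); rewrite /I; move: (1 - _) => y y0.
  have p0 : pi != 0 :> R by rewrite gt_eqF.
  rewrite exprMn exprVn [pi ^+ _.+1]exprS; move: pi p0 => p p0; field.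
  by rewrite f0 p0 !expf_neq0// gt_eqF.
have := has_nnintegral_prod_sum _ _ _ _ _ f I fI.
congr has_nnintegral; last first.
  by apply: eq_bigr => j _; rewrite big_bool /I /sl/= mulNr !opprK.
apply/funext => z /=; rewrite -big_split/=; apply: eq_bigr => j _.
have E x : expR (- (x * m j)) * expR (- (pi * (1 - x) * sqmod z j)) =
    expR (x * (pi * sqmod z j - m j)) * expR (- (pi * sqmod z j)).
  by rewrite -!expRD; congr expR; ring.
rewrite big_bool /f /sl/= ![_ * expR _ * (_ * expR _)]mulrACA !E mulNr; ring.
Qed.

End phase_space_density.

(** * Comparison of a radial moderate function with its value at fixed radii *)

Section radial_weight.
Context {R : realType} {d : nat}.
Implicit Types (z : 'rV[R]_(d + d)).

Definition radial_point (p : 'I_d -> R) : 'rV[R]_(d + d) :=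
  row_mx (\row_j p j) 0.

Lemma radial_point_lshift (p : 'I_d -> R) j :
  radial_point p ord0 (lshift d j) = p j.
Proof. by rewrite /radial_point row_mxEl mxE. Qed.

Lemma radial_point_rshift (p : 'I_d -> R) j :
  radial_point p ord0 (rshift d j) = 0.
Proof. by rewrite /radial_point row_mxEr mxE. Qed.

(** Both points have the same moduli. Passing to the real representative turns distances between
    points into differences of radii. *)
Lemma tf_radial_point (theta : 'rV[R]_(d + d) -> R) z : tf_radial theta ->
  theta z = theta (radial_point (fun j => Num.sqrt (sqmod z j))).
Proof.
case=> theta0 thetaE; rewrite !thetaE; congr theta0.
apply/rowP => j; rewrite !mxE !normc_tf_coord [in RHS]/sqmod.
by rewrite radial_point_lshift radial_point_rshift expr0n addr0 sqr_sqrtr ?sqmod_ge0.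
Qed.

Lemma sum_radial_pointB (p q : 'I_d -> R) :
  \sum_i `|(radial_point p - radial_point q) ord0 i| = \sum_j `|p j - q j|.
Proof.
rewrite big_split_ord/= [X in _ + X]big1 ?addr0; last first.
  by move=> j _; rewrite mxE [X in _ + X]mxE !radial_point_rshift subrr normr0.
by apply: eq_bigr => j _; rewrite mxE [X in _ + X]mxE !radial_point_lshift.
Qed.

(** Moderateness bounds theta(z) / q and its inverse by an exponential [W] in the differences of
    radii; [powR_le_weight] passes to powers, and [expR_dist_le] bounds [W] to the power [S] by
    [Y]. *)
Lemma radial_comparison (w theta : 'rV[R]_(d + d) -> R) (K c S u : R)
    (p : 'I_d -> R) z :
  submultiplicative_weight w -> moderate w theta -> tf_radial theta ->
  1 <= K -> 0 <= c -> (forall v, w v <= K * expR (c * \sum_i `|v ord0 i|)) ->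
  (forall j, 0 < p j) -> `|u| <= S ->
  let q := theta (radial_point p) in
  let Y := K `^ S * \prod_(j < d)
    (expR (S * c / p j * (sqmod z j - p j ^+ 2)) +
     expR (- (S * c / p j * (sqmod z j - p j ^+ 2)))) in
  [/\ 0 < Y, q `^ u / Y <= theta z `^ u & theta z `^ u <= q `^ u * Y].
Proof.
move=> ww [_ mod] rad K1 c0 wK p0 uS q Y.
have theta0 v : 0 < theta v by have [] := mod v 0; rewrite addr0.
have S0 : 0 <= S by exact: le_trans uS.
have K0 : 0 < K by exact: lt_le_trans K1.
have wN : forall v, w (- v) = w v by case: ww.
pose r j := Num.sqrt (sqmod z j).
pose v := radial_point r - radial_point p.
pose W := K * expR (c * \sum_j `|r j - p j|).
have wW : w v <= W by rewrite (le_trans (wK _))// sum_radial_pointB.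
have W1 : 1 <= W by rewrite (le_trans _ wW)// submultiplicative_weight_ge1.
have W0 : 0 < W by exact: lt_le_trans W1.
have zW : theta z <= W * q.
  rewrite (tf_radial_point _ _ rad) -/r.
  have [_] := mod v (radial_point p); rewrite subrK => /le_trans; apply.
  by rewrite ler_pM2r.
(* The opposite shift has the same weight, as w is even. *)
have qW : q <= W * theta z.
  rewrite [theta z](tf_radial_point _ _ rad) -/r.
  have [_] := mod (- v) (radial_point r); rewrite wN opprB subrK => /le_trans; apply.
  by rewrite ler_pM2r.
have q0 : 0 < q by exact: theta0.
have [|| lo up] := powR_le_weight (theta z / q) W u S W1 _ _ uS.
- by rewrite ler_pdivlMr// mulrC ler_pdivrMr// mulrC.
- by rewrite ler_pdivrMr.
have thetaE : theta z `^ u = q `^ u * (theta z / q) `^ u.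
  by rewrite -powRM ?divr_ge0 ?ltW// mulrCA divff ?mulr1// gt_eqF.
have qu0 : 0 < q `^ u by exact: powR_gt0.
have WS0 : 0 < W `^ S by exact: powR_gt0.
have WY : W `^ S <= Y.
  rewrite /W (powRM _ (ltW K0) (expR_ge0 _)) -expRM /Y ler_pM2l ?powR_gt0//.
  rewrite mulrAC [c * S]mulrC mulr_sumr expR_sum; apply: ler_prod => j _.
  rewrite expR_ge0/=; have := expR_dist_le (S * c) (r j) (p j).
  by rewrite sqr_sqrtr ?sqmod_ge0//; apply; rewrite ?mulr_ge0 ?sqrtr_ge0.
have Y0 : 0 < Y by exact: lt_le_trans WY.
split => //.
- rewrite thetaE ler_pM2l// (le_trans _ lo)//.
  by rewrite lef_pV2.
- by rewrite thetaE ler_pM2l// (le_trans up).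
Qed.

End radial_weight.

(** * Centres and tilts, uniformly in the degree *)

Section uniform_bound.
Context {R : realType}.

(* The point around which the radius concentrates; the shift by [N] keeps the
   tilt [c / (pi * p)] below [1 / 2]. *)
Definition center (N a : nat) : R := Num.sqrt ((a + N)%:R / pi).

Lemma center_gt0 N a : (0 < N)%N -> 0 < center N a.
Proof.
by move=> N0; rewrite sqrtr_gt0 divr_gt0 ?pi_gt0// ltr0n addn_gt0 N0 orbT.
Qed.

(** Since p^2 = (a + N) / pi, the quantity l^2 (a + N) equals c^2 / pi whatever a is; N >= 4 c^2 /
    pi then forces l^2 <= 1/4. *)
Lemma tilt_bound (c : R) (N a : nat) (l := c / (pi * center N a)) : 0 <= c ->
  (0 < N)%N -> 4 * (c ^+ 2 / pi) <= N%:R ->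
  0 <= l <= 2^-1 /\ l ^+ 2 * (a + N)%:R = c ^+ 2 / pi.
Proof.
move=> c0 N0 cN; have p0 := center_gt0 N a N0.
have pi0 : 0 < pi :> R by exact: pi_gt0.
have m0 : 0 < (a + N)%:R :> R by rewrite ltr0n addn_gt0 N0 orbT.
have l0 : 0 <= l by apply: divr_ge0 => //; apply: mulr_ge0; exact: ltW.
have lm : l ^+ 2 * (a + N)%:R = c ^+ 2 / pi.
  rewrite /l expr_div_n exprMn sqr_sqrtr ?divr_ge0 ?ltW//.
  have := lt0r_neq0 pi0; have := lt0r_neq0 m0.
  by move: pi (_%:R) => x y y0 x0; field; rewrite x0 y0.
split => //; rewrite l0/=; rewrite leNgt; apply/negP => l2.
have Nm : N%:R <= (a + N)%:R :> R by rewrite ler_nat leq_addl.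
move: cN; rewrite -lm; move: (l) l2 => x x2.
have : 4^-1 < x ^+ 2 by rewrite expr2; nra.
by move: (x ^+ 2) => y; nra.
Qed.

End uniform_bound.

(** * One constant for all multi-indices and all three exponents *)

Theorem proposition3p6 (R : realType) (d : nat)
    (w theta : 'rV[R]_(d + d) -> R) :
  submultiplicative_weight w ->
  moderate w theta ->
  continuous theta ->
  tf_radial theta ->
  forall s t : R, exists C : R, 0 < C /\
    forall alpha : 'I_d -> nat,
      ((C^-1)%:E <= tau alpha s theta * tau alpha t theta
                    * tau alpha (- s - t) theta)%E /\
      (tau alpha s theta * tau alpha t theta
       * tau alpha (- s - t) theta <= C%:E)%E.
Proof.
move=> ww mod _ rad s t.
have [K [cw [K1 cw0 wK]]] := submultiplicative_weight_exp _ _ ww.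
(* [S] bounds |s|, |t| and |s + t| at once, so a single [M] serves the three integrals. *)
pose S := `|s| + `|t|.
have S0 : 0 <= S by rewrite addr_ge0.
pose c := S * cw; have c0 : 0 <= c by rewrite mulr_ge0.
have pi0 : 0 < pi :> R by exact: pi_gt0.
pose b : R := c ^+ 2 / pi; have b0 : 0 <= b by rewrite divr_ge0 ?sqr_ge0// ltW.
pose N := (Num.truncn (4 * b)).+1.
have bN : 4 * b <= N%:R by apply/ltW; have /andP[] := truncn_itv (mulr_ge0 (ler0n R 4) b0).
(* [Q] bounds the contribution of one coordinate, with one summand for each sign of the tilt. *)
pose Q := expR (2 * b) + expR (N%:R + b).
have Q0 : 0 < Q by rewrite addr_gt0 ?expR_gt0.
have KS0 : 0 < K `^ S by rewrite powR_gt0// (lt_le_trans _ K1).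
pose M := K `^ S * Q ^+ d.
have M0 : 0 < M by rewrite mulr_gt0 ?exprn_gt0.
exists (M ^+ 3); split; first exact: exprn_gt0.
move=> alpha.
pose p j : R := center N (alpha j).
have p0 j : 0 < p j by exact: center_gt0.
pose q := theta (radial_point p).
have q0 : 0 < q by have [_ /(_ (radial_point p) 0)[]] := mod; rewrite addr0.
(* [M] is fixed before alpha, which enters these bounds only through [q]. *)
have bound u : `|u| <= S ->
    ((q `^ u / M)%:E <= tau alpha u theta <= (q `^ u * M)%:E)%E.
  move=> uS; rewrite tau_densityE.
  pose l j := c / (pi * p j).
  have lP j := tilt_bound c N (alpha j) c0 erefl bN.
  have l1 j : `|l j| < 1.
    by have [/andP[l0 l2] _] := lP j; rewrite ger0_norm//; rewrite -/(l j) in l2; lra.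
  (* The tilt of the Gamma variable pi |z_j|^2 about alpha_j + N is the exponent of
     [radial_comparison] about p_j^2. *)
  have lE j z : l j * (pi * sqmod z j - (alpha j + N)%:R) =
      S * cw / p j * (sqmod z j - p j ^+ 2).
    rewrite /l -/c /p /center sqr_sqrtr; last by rewrite divr_ge0// ltW.
    have := lt0r_neq0 (p0 j); rewrite /p /center; move: (Num.sqrt _) => x x0.
    by have := lt0r_neq0 pi0; move: pi => y y0; field; rewrite x0 y0.
  have hYD := has_nnintegralZ (ltW KS0)
    (density_tilted alpha l (fun j => (alpha j + N)%:R) l1).
  pose Y z : R := K `^ S * \prod_(j < d)
    (expR (S * cw / p j * (sqmod z j - p j ^+ 2)) +
     expR (- (S * cw / p j * (sqmod z j - p j ^+ 2)))).
  apply: (integral_sandwich (Y := Y) (density_integral alpha) _ _ M0).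
  - move: hYD; congr has_nnintegral; apply/funext => z; rewrite mulrA; congr (_ * _ * _).
    by apply: eq_bigr => j _; rewrite lE.
  - rewrite ler_pM2l//; have -> : Q ^+ d = \prod_(j < d) Q.
      by rewrite prodr_const card_ord.
    apply: ler_prod => j _; have [l2 lm] := lP j.
    have {}l2 : 0 <= l j <= 2^-1 by [].
    have /andP[l0 _] := l2; apply/andP; split.
      have := l1 j; rewrite ger0_norm// => lj1.
      by apply: addr_ge0; apply: mulr_ge0;
        rewrite ?expR_ge0// exprn_ge0// invr_ge0; lra.
    by apply: lerD; [exact: gamma_laplace_le|exact: gamma_laplaceN_le].
  - exact: powR_gt0.
  - have mtheta : measurable_fun setT theta by case: mod => -[].
    exact: (measurableT_comp (measurable_powR u) mtheta).
  - move=> z; exact: (radial_comparison w theta K cw S u p z ww mod rad K1 cw0 wK p0 uS).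
have hs : `|s| <= S by rewrite lerDl.
have ht : `|t| <= S by rewrite lerDr.
have hst : `|- s - t| <= S by rewrite (le_trans (ler_normB _ _))// normrN.
have q1 : q `^ s * q `^ t * q `^ (- s - t) = 1.
  have e x y : q `^ x * q `^ y = q `^ (x + y) by rewrite powRD ?(gt_eqF q0) ?implybT.
  by rewrite !e (_ : s + t + _ = 0) ?powRr0//; ring.
move: (bound _ hs) (bound _ ht) (bound _ hst) q1.
have := powR_gt0 s q0; have := powR_gt0 t q0; have := powR_gt0 (- s - t) q0.
move: (q `^ _) (q `^ _) (q `^ _) => x1 x2 x3 x30 x20 x10.
(* The two finite bounds exclude infinite values, leaving a computation with real numbers. *)
case: (tau _ _ _) => [y1| |]; rewrite ?leNye_eq ?leeNy_eq ?andbF// => /andP[l1 u1].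
case: (tau _ _ _) => [y2| |]; rewrite ?leNye_eq ?leeNy_eq ?andbF// => /andP[l2 u2].
case: (tau _ _ _) => [y3| |]; rewrite ?leNye_eq ?leeNy_eq ?andbF// => /andP[l3 u3].
rewrite -!EFinM !lee_fin in l1 u1 l2 u2 l3 u3 * => x1E.
have d0 x : 0 < x -> 0 <= x / M by move=> x0; rewrite divr_ge0// ltW.
have y0 x y : 0 < x -> x / M <= y -> 0 <= y by move=> /d0/le_trans; apply.
split.
(* As the three powers of [q] multiply to 1, only the cube of [M] survives in the product of the
   bounds. *)
- have -> : (M ^+ 3)^-1 = x1 / M * (x2 / M) * (x3 / M).
    rewrite -[LHS]mul1r -x1E; field.
    by rewrite gt_eqF.
  by apply: ler_pM => //; [exact: mulr_ge0 (d0 _ x10) (d0 _ x20)|exact: d0|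
    apply: ler_pM => //; exact: d0].
- have -> : M ^+ 3 = x1 * M * (x2 * M) * (x3 * M).
    by rewrite -[LHS]mul1r -x1E; ring.
  have y10 := y0 _ _ x10 l1; have y20 := y0 _ _ x20 l2; have y30 := y0 _ _ x30 l3.
  by apply: ler_pM => //; [exact: mulr_ge0|apply: ler_pM].
Qed.
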